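(* Let $n\ge 1$ and let $F$ be a unitary on $n$ qubits with phase polynomial representation $(p,f)$, i.e. $F|x\rangle = e^{i p(x)}|f(x)\rangle$ for all $x\in\{0,1,\dots,2^n-1\}$. Then $F$ can be replaced by classical pre- or post-processing in the following sense. (1) (Pre-processing.) For every $x\in\{0,\dots,2^n-1\}$, preparing $|x\rangle$ and then applying $F$ produces the same quantum state (i.e. the same state up to a global phase) as preparing $|f(x)\rangle$: $F|x\rangle\langle x|F^\dagger = |f(x)\rangle\langle f(x)|$. (2) (Post-processing.) For every $n$-qubit density matrix $\rho$, applying $F$ to $\rho$ and then measuring all qubits in the computational basis yields the same outcome distribution as measuring $\rho$ in the computational basis and then applying the function $f$ to the outcome: for every $y\in\{0,\dots,2^n-1\}$, $$\langle y|F\rho F^\dagger|y\rangle=\sum_{x:\,f(x)=y}\langle x|\rho|x\rangle .$$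
   Context: The Hilbert space of $n$ qubits is $(\mathbb{C}^2)^{\otimes n}$ with computational basis $|0\rangle,\dots,|2^n-1\rangle$, where $|x\rangle=\bigotimes_{k=1}^n|x_k\rangle$ and $x_k$ is the $k$-th binary digit of $x$. A unitary $U$ on $n$ qubits has phase polynomial representation $(p,f)$ if $U|x\rangle=e^{ip(x)}|f(x)\rangle$ for all $x\in\{0,\dots,2^n-1\}$, where $p:\{0,\dots,2^n-1\}\to\mathbb{R}$ is an arbitrary real function (not necessarily a polynomial) and $f:\{0,\dots,2^n-1\}\to\{0,\dots,2^n-1\}$. Measuring a density matrix $\rho$ in the computational basis gives outcome $x$ with probability $\langle x|\rho|x\rangle$. *)

(* Defs.v *)
From mathcomp Require Import all_boot all_order all_algebra.
From mathcomp Require Import spectral sesquilinear.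
From mathcomp Require Import complex.
(* mxtens is not imported: its notation "A ^t k" clashes with "M ^t phi". *)
From mathcomp Require mxtens.
From mathcomp Require Import reals trigo.

Set Implicit Arguments.
Unset Strict Implicit.
Unset Printing Implicit Defensive.

Import Order.TTheory GRing.Theory Num.Theory.
Local Open Scope ring_scope.
Local Open Scope sesquilinear_scope.

Definition expi {R : realType} (t : R) : R[i] := (cos t +i* sin t)%C.

(* Pure states of n qubits are column vectors of (C^2)^{(x) n} = C^(2^n);
   [qtens v] is the Kronecker product v_0 (x) ... (x) v_(n-1), in this order. *)
Fixpoint qtens {R : realType} {n : nat} :
    ('I_n -> 'cV[R[i]]_2) -> 'cV[R[i]]_(2 ^ n) :=
  if n is m.+1 then fun v =>
    castmx (esym (expnS 2 m), muln1 1)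
      (mxtens.tensmx (v ord0) (qtens (fun k => v (lift ord0 k))))
  else fun=> const_mx 1.

Definition qubit {R : realType} (b : bool) : 'cV[R[i]]_2 := delta_mx (inord b) 0.

(* The binary digits of x over n bits, most significant first. *)
Definition digit (n x : nat) (k : 'I_n) : bool := odd (x %/ 2 ^ (n - k.+1)).

Definition ket {R : realType} {n : nat} (x : 'I_(2 ^ n)) : 'cV[R[i]]_(2 ^ n) :=
  qtens (fun k => qubit (digit x k)).

Lemma ketE (R : realType) (n : nat) (x : 'I_(2 ^ n)) :
  ket x = delta_mx x 0 :> 'cV[R[i]]_(2 ^ n).
Proof.
suff H (y : nat) (i : 'I_(2 ^ n)) (j : 'I_1) : (y < 2 ^ n)%N ->
    qtens (fun k => qubit (digit y k)) i j = (i == y :> nat)%:R :> R[i].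
  by apply/matrixP => i j; rewrite /ket H // !mxE [j]ord1 eqxx andbT.
elim: n {x} => [|n IHn] in y i j *.
  by case: y => // _ /=; rewrite mxE; case: i => [[]].
move=> lty; rewrite /= castmxE mxE.
set a := (mxtens.mxtens_unindex _).1; set b := (mxtens.mxtens_unindex _).2.
have n0 : (0 < 2 ^ n)%N by rewrite expn_gt0.
have -> : (fun k => qubit (digit y (lift ord0 k)))
   = (fun k : 'I_n => qubit (digit (y %% 2 ^ n) k)) :> ('I_n -> 'cV[R[i]]_2).
  apply: boolp.funext => k; congr (delta_mx (inord (nat_of_bool _)) 0).
  rewrite /digit lift0 subSS [in LHS](divn_eq y (2 ^ n)).
  have kn : (2 ^ n = 2 ^ k.+1 * 2 ^ (n - k.+1))%N by rewrite -expnD subnKC.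
  by rewrite {2}kn mulnA divnMDl ?expn_gt0 // oddD oddM oddX andbF.
rewrite IHn ?ltn_pmod //.
rewrite /qubit mxE /digit subn1 /=.
have y1 : (y %/ 2 ^ n < 2)%N by rewrite ltn_divLR // -expnS.
have -> : (odd (y %/ 2 ^ n) : nat) = (y %/ 2 ^ n)%N by case: (_ %/ _)%N y1 => [|[]].
rewrite [X in (_ && X)](_ : _ = true); last by apply/eqP; rewrite ord1.
rewrite andbT -natrM mulnb -val_eqE /= inordK //=.
congr ((nat_of_bool _)%:R); apply/idP/idP.
  by case/andP => /eqP e1 /eqP e2; rewrite (divn_eq i (2 ^ n)) e1 e2 -divn_eq.
by move=> /eqP ->; rewrite !eqxx.
Qed.

Definition phase_poly_repr {R : realType} {n : nat} (U : 'M[R[i]]_(2 ^ n))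
    (p : 'I_(2 ^ n) -> R) (f : 'I_(2 ^ n) -> 'I_(2 ^ n)) : Prop :=
  forall x, U *m ket x = expi (p x) *: ket (f x).

Definition same_up_to_phase {R : realType} {n : nat}
    (u v : 'cV[R[i]]_(2 ^ n)) : Prop :=
  exists t : R, u = expi t *: v.

Definition density_matrix {R : realType} {n : nat} (rho : 'M[R[i]]_(2 ^ n)) :=
  [/\ rho \is hermsymmx,
      forall v : 'cV[R[i]]_(2 ^ n), 0 <= (v ^t* *m rho *m v) 0 0
    & \tr rho = 1].

Definition outcome_prob {R : realType} {n : nat} (rho : 'M[R[i]]_(2 ^ n))
    (x : 'I_(2 ^ n)) : R[i] :=
  ((ket x) ^t* *m rho *m ket x) 0 0.

(* Main.v *)
(** Applying the adjoint of the unitary [F] to [F |x> = e^(i p(x)) |f(x)>] gives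
    [F^dagger |f(x)> = e^(-i p(x)) |x>]. Hence [f] is injective, so a permutation
    of the finite set of basis labels: the sum over [f x = y] has a single term
    [x], and in [<y| F rho F^dagger |y>] with [y = f x] the two phases cancel. *)

Require Import Defs.
From mathcomp Require Import all_boot all_order all_algebra.
From mathcomp Require Import spectral sesquilinear complex reals trigo.

Set Implicit Arguments.
Unset Strict Implicit.
Unset Printing Implicit Defensive.

Import GRing.Theory Num.Theory.
Local Open Scope ring_scope.
Local Open Scope sesquilinear_scope.

Lemma expi_conj (R : realType) (t : R) : expi t * (expi t)^* = 1.
Proof.
rewrite /expi; apply/eqP; rewrite eq_complex /=; apply/andP; split; apply/eqP.
  by rewrite mulrN opprK -!expr2 cos2Dsin2.
by rewrite mulrN mulrC addNr.
Qed.

Lemma adjmxM (C : numClosedFieldType) (m n k : nat)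
    (A : 'M[C]_(m, n)) (B : 'M[C]_(n, k)) :
  (A *m B) ^t* = B ^t* *m A ^t*.
Proof. by rewrite trmx_mul map_mxM. Qed.

Lemma adjmxZ (C : numClosedFieldType) (m n : nat) (a : C) (A : 'M[C]_(m, n)) :
  (a *: A) ^t* = a^* *: A ^t*.
Proof. by rewrite linearZ /= map_mxZ. Qed.

(** A phase has modulus 1, so it cancels against its conjugate across any middle factor. Both halves
    of the theorem use this: [A] is the identity for the projector and [rho] for the measurement. *)
Lemma phase_proj (R : realType) (m n k : nat) (t : R)
    (u : 'M[R[i]]_(m, n)) (A : 'M[R[i]]_n) (v : 'M[R[i]]_(n, k)) :
  (expi t *: u) *m A *m ((expi t)^* *: v) = u *m A *m v.
Proof. by rewrite -!scalemxAl -scalemxAr scalerA expi_conj scale1r. Qed.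

(** Coordinate [x] of the left side is [a]; on the right it vanishes unless [x = y]. *)
Lemma ket_scale_inj (R : realType) (n : nat) (a b : R[i]) (x y : 'I_(2 ^ n)) :
  a != 0 -> a *: ket x = b *: ket y -> x = y.
Proof.
move=> a0 /matrixP/(_ x 0); rewrite !ketE !mxE !eqxx mulr1 andbT.
by case: eqP => // _ /eqP; rewrite mulr0 (negPf a0).
Qed.

Lemma adj_phase_poly (R : realType) (n : nat) (F : 'M[R[i]]_(2 ^ n))
    (p : 'I_(2 ^ n) -> R) (f : 'I_(2 ^ n) -> 'I_(2 ^ n)) :
  F \is unitarymx -> phase_poly_repr F p f ->
  forall x, F ^t* *m ket (f x) = (expi (p x))^* *: ket x.
Proof.
move=> hF hpf x.
(* Unitarity provides the product in the other order; for square matrices a right inverse is also a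
   left inverse. *)
have FF : F ^t* *m F = 1%:M by apply: mulmx1C; apply/unitarymxP.
have := congr1 (fun v => (expi (p x))^* *: (F ^t* *m v)) (hpf x).
by rewrite mulmxA FF mul1mx -scalemxAr scalerA mulrC expi_conj scale1r.
Qed.

Lemma phase_poly_inj (R : realType) (n : nat) (F : 'M[R[i]]_(2 ^ n))
    (p : 'I_(2 ^ n) -> R) (f : 'I_(2 ^ n) -> 'I_(2 ^ n)) :
  F \is unitarymx -> phase_poly_repr F p f -> injective f.
Proof.
move=> hF hpf x x' fxx'; have adjF := adj_phase_poly hF hpf.
apply: (@ket_scale_inj R n (expi (p x))^* (expi (p x'))^*); last
  by rewrite -!adjF fxx'.
(* A vanishing conjugate phase would turn [expi_conj] into [0 = 1]. *)
by apply: contraTneq (oner_neq0 R[i]) => e0; rewrite -(expi_conj (p x)) e0 mulr0 eqxx.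
Qed.

Theorem mainTheorem1 (R : realType) (n : nat) (hn : (1 <= n)%N)
    (F : 'M[R[i]]_(2 ^ n)) (hF : F \is unitarymx)
    (p : 'I_(2 ^ n) -> R) (f : 'I_(2 ^ n) -> 'I_(2 ^ n))
    (hpf : phase_poly_repr F p f) :
  (forall x : 'I_(2 ^ n),
     same_up_to_phase (F *m ket x) (ket (f x)) /\
     F *m (ket x *m (ket x) ^t* ) *m F ^t* = ket (f x) *m (ket (f x)) ^t* ) /\
  (forall rho : 'M[R[i]]_(2 ^ n), density_matrix rho ->
     forall y : 'I_(2 ^ n),
       outcome_prob (F *m rho *m F ^t* ) y = \sum_(x | f x == y) outcome_prob rho x).
Proof.
split=> [x | rho _ y].
  split; first by exists (p x); exact: hpf.
  rewrite mulmxA -mulmxA -adjmxM hpf adjmxZ.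
  (* An identity matrix is inserted between ket and bra as the middle factor. *)
  by rewrite -[_ *: ket _]mulmx1 phase_proj mulmx1.
have injf := phase_poly_inj hF hpf; have [g fK gK] := injF_bij injf.
rewrite -(gK y) (big_pred1 (g y)) => [|x]; last by rewrite (inj_eq injf).
have adjF := adj_phase_poly hF hpf (g y).
(* The bra form of [adjF]: taking adjoints conjugates the phase back to [expi (p (g y))]. *)
have Fadj : (ket (f (g y))) ^t* *m F = expi (p (g y)) *: (ket (g y)) ^t*.
  by rewrite -[F in LHS]trmxCK -adjmxM adjF adjmxZ conjCK.
by rewrite /outcome_prob !mulmxA Fadj -[_ *m _ *m _ *m ket _]mulmxA adjF phase_proj.
Qed.
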